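(* For every balanced design $\mathbf{X}\in\mathscr{U}(n,q^s)$, the nonorthogonality criterion $\mathrm{Ave}(\chi^2)$ satisfies $$\mathrm{Ave}(\chi^2)=\frac{2}{s(s-1)}\Psi(\mathbf{X};\beta^2)+a\ \ge\ \frac{n(n-1)}{s(s-1)}\left(\theta^2+2\theta f+f\right)+a,$$ where the constant $a=\dfrac{q^2ns+n^2(1-s-q)}{q^2(s-1)}$.
   Context: Let $n,q\ge2$, $s\ge2$ be integers. A lattice design $\mathbf{X}(n,q^s)$ is a collection of $n$ points (runs, repetitions allowed) $\mathbf{x}_1,\dots,\mathbf{x}_n\in\{0,1,\dots,q-1\}^s$, written as an $n\times s$ matrix $(x_{ij})$; it is balanced if in each column each of the $q$ levels appears $n/q$ times. $\mathscr{U}(n,q^s)$ is the set of balanced designs. $\mathrm{Ave}(\chi^2)=\frac{2}{s(s-1)}\sum_{1\le j<l\le s}\sum_{\tau_1,\tau_2}\left(N^{(j,l)}_{\tau_1,\tau_2}-\frac{n}{q^2}\right)^2$, where $\tau_1,\tau_2$ each range over the $q$ levels and $N^{(j,l)}_{\tau_1,\tau_2}$ is the number of runs whose factors (columns) $j,l$ take the level combination $(\tau_1,\tau_2)$. With $m=n(n-1)/2$, let $\beta_1,\dots,\beta_m$ be the list of pairwise coincidences $\beta(\mathbf{x}_i,\mathbf{x}_k)=\sum_{j=1}^s\delta_{x_{ij},x_{kj}}$ for $1\le i<k\le n$, and $\Psi(\mathbf{X};\beta^2)=\sum_{r=1}^m\beta_r^2$. $\theta$ and $f$ are the integral and fractional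 parts of $\bar\beta=\frac{s(n-q)}{q(n-1)}$: $\theta=\lfloor\bar\beta\rfloor$, $f=\bar\beta-\theta$. *)

(* Defs.v *)
From mathcomp Require Import all_boot all_order all_algebra.

Set Implicit Arguments.
Unset Strict Implicit.
Unset Printing Implicit Defensive.

Import Order.TTheory GRing.Theory Num.Theory.

Local Open Scope ring_scope.

(* A design with n runs (rows) and s factors (columns) on the levels 0..q-1.
   Runs may be repeated. *)
Definition design (n q s : nat) := 'M['I_q]_(n, s).

(* Each level occurs n/q times in each column, the division being exact. *)
Definition balanced (n q s : nat) (X : design n q s) : Prop :=
  forall (j : 'I_s) (t : 'I_q), (#|[set i : 'I_n | X i j == t]| * q = n)%N.

Definition pair_count (n q s : nat) (X : design n q s)
    (j l : 'I_s) (t1 t2 : 'I_q) : nat :=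
  #|[set i : 'I_n | (X i j == t1) && (X i l == t2)]|.

Definition ave_chi2 (R : archiRealFieldType) (n q s : nat)
    (X : design n q s) : R :=
  2 / (s%:R * (s%:R - 1)) *
  \sum_(j < s) \sum_(l < s | (j < l)%N) \sum_(t1 < q) \sum_(t2 < q)
    ((pair_count X j l t1 t2)%:R - n%:R / q%:R ^+ 2) ^+ 2.

Definition coincidence (n q s : nat) (X : design n q s) (i k : 'I_n) : nat :=
  (\sum_(j < s) (X i j == X k j))%N.

(* The m = n(n-1)/2 coincidences beta_r are indexed by the pairs i < k. *)
Definition Psi_sqr (n q s : nat) (X : design n q s) : nat :=
  (\sum_(i < n) \sum_(k < n | i < k) coincidence X i k ^ 2)%N.

Definition beta_bar (R : archiRealFieldType) (n q s : nat) : R :=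
  s%:R * (n%:R - q%:R) / (q%:R * (n%:R - 1)).

Definition theta (R : archiRealFieldType) (n q s : nat) : R :=
  (Num.floor (beta_bar R n q s))%:~R.

Definition fpart (R : archiRealFieldType) (n q s : nat) : R :=
  beta_bar R n q s - theta R n q s.

Definition chi2_const (R : archiRealFieldType) (n q s : nat) : R :=
  (q%:R ^+ 2 * n%:R * s%:R + n%:R ^+ 2 * (1 - s%:R - q%:R))
    / (q%:R ^+ 2 * (s%:R - 1)).

(* Main.v *)
Require Import Defs.
From mathcomp Require Import all_boot all_order all_algebra.
From mathcomp Require Import zify ring lra.
Import Order.TTheory GRing.Theory Num.Theory.
Local Open Scope ring_scope.

(** Squaring a coincidence number and summing over all ordered pairs of runs
    counts the quadruples (i, k, j, l) such that runs i and k agree in both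
    columns j and l; for fixed j and l these number the sum of the squared pair
    counts N^(j,l). Splitting off the diagonals i = k and j = l, which balance
    makes constant, gives the identity. Balance also fixes the mean of the
    coincidence numbers to be beta_bar, and an integer b always satisfies
    (b - theta)(b - theta - 1) >= 0; summing this over the pairs of runs gives
    the lower bound. *)

Lemma card_fiber_sum (I T : finType) (f : I -> T) (t : T) :
  #|[set i | f i == t]| = (\sum_i (f i == t))%N.
Proof. by rewrite -sum1_card big_mkcond; apply: eq_bigr => i _; rewrite inE; case: eqP. Qed.

Lemma sum_card_fiber (I T : finType) (f : I -> T) :
  (\sum_t #|[set i | f i == t]|)%N = #|I|.
Proof.
rewrite -sum1_card (partition_big f xpredT) //=.
by apply: eq_bigr => t _; rewrite -sum1_card; apply: eq_bigl => i; rewrite inE.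
Qed.

(** Both sides count ordered pairs lying in a common fiber: with [i] grouped by its value [t], each
    [i] over [t] contributes the size of that fiber. *)
Lemma sum_sqr_card_fiber (I T : finType) (f : I -> T) :
  (\sum_t #|[set i | f i == t]| ^ 2 = \sum_i \sum_k (f i == f k))%N.
Proof.
rewrite [RHS](partition_big f xpredT) //=; apply: eq_bigr => t _.
rewrite [RHS](eq_bigr (fun=> #|[set i | f i == t]|)); last first.
  by move=> i /eqP <-; rewrite card_fiber_sum; apply: eq_bigr => k _; rewrite eq_sym.
rewrite sum_nat_const -mulnn; congr (_ * _)%N.
by apply: eq_card => i; rewrite inE.
Qed.

Lemma sum_symmetric (R : pzSemiRingType) (n : nat) (F : 'I_n -> 'I_n -> nat) :
  (forall i k, F i k = F k i) ->
  (\sum_i \sum_k F i k)%N%:R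
    = 2 * (\sum_(i < n) \sum_(k < n | i < k) F i k)%N%:R
      + \sum_i (F i i)%:R :> R.
Proof.
move=> Fsym; rewrite -natr_sum -natrM -natrD; congr _%:R.
have -> : (\sum_i \sum_k F i k = \sum_(i < n) (\sum_(k < n | i < k) F i k
    + \sum_(k < n | k < i) F i k + F i i))%N.
  apply: eq_bigr => i _; rewrite (bigID (fun k : 'I_n => (i < k)%N)) /= -addnA.
  congr (_ + _)%N; rewrite (bigD1 i) ?ltnn //= addnC; congr (_ + _)%N.
  by apply: eq_bigl => k; rewrite -leqNgt [RHS]ltn_neqAle andbC.
rewrite !big_split /= mul2n -addnn; congr (_ + _ + _)%N.
(* Swapping the two indices turns the part below the diagonal into the part above it. *)
rewrite (exchange_big_dep xpredT) //=; apply: eq_bigr => i _.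
by apply: eq_bigr => k _; rewrite Fsym.
Qed.

Lemma card_pairs_lt (R : pzRingType) (n : nat) :
  2 * (\sum_(i < n) \sum_(k < n | (i < k)%N) 1)%N%:R = n%:R * (n%:R - 1) :> R.
Proof.
have := sum_symmetric R n (fun _ _ => 1%N) (fun _ _ => erefl).
rewrite !sum_nat_const !sumr_const !card_ord muln1 natrM => E.
by rewrite mulrBr mulr1 E addrK.
Qed.

Section Designs.

Variables (R : archiRealFieldType) (n q s : nat) (X : design n q s).

Lemma coincidence_sym (i k : 'I_n) : coincidence X i k = coincidence X k i.
Proof. by apply: eq_bigr => j _; rewrite eq_sym. Qed.

Lemma coincidence_diag (i : 'I_n) : coincidence X i i = s.
Proof.
rewrite -[RHS]card_ord -sum1_card.
by apply: eq_bigr => j _; rewrite eqxx.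
Qed.

(** Makes the general fiber counts applicable to the map sending a run to its pair of levels in
    columns [j] and [l]. *)
Lemma pair_count_fiber (j l : 'I_s) (t1 t2 : 'I_q) :
  pair_count X j l t1 t2 = #|[set i | (X i j, X i l) == (t1, t2)]|.
Proof. by apply: eq_card => i; rewrite !inE. Qed.

Lemma sum_pair_count (j l : 'I_s) :
  (\sum_(t1 < q) \sum_(t2 < q) pair_count X j l t1 t2)%N = n.
Proof.
rewrite pair_big /= -[RHS]card_ord -(sum_card_fiber _ _ (fun i => (X i j, X i l))).
by apply: eq_bigr => -[t1 t2] _; rewrite pair_count_fiber.
Qed.

Lemma sum_sqr_pair_count (j l : 'I_s) :
  (\sum_(t1 < q) \sum_(t2 < q) pair_count X j l t1 t2 ^ 2
   = \sum_(i < n) \sum_(k < n) (X i j == X k j) * (X i l == X k l))%N.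
Proof.
rewrite pair_big /=.
rewrite (eq_bigr (fun t => #|[set i | (X i j, X i l) == t]| ^ 2)%N); last first.
  by move=> [t1 t2] _; rewrite pair_count_fiber.
rewrite sum_sqr_card_fiber; do 2![apply: eq_bigr => ? _].
by rewrite xpair_eqE mulnb.
Qed.

Lemma sum_sqr_coincidence :
  (\sum_(i < n) \sum_(k < n) coincidence X i k ^ 2
   = \sum_(j < s) \sum_(l < s) \sum_(t1 < q) \sum_(t2 < q)
       pair_count X j l t1 t2 ^ 2)%N.
Proof.
under [RHS]eq_bigr => j _ do
  [under eq_bigr => l _ do rewrite sum_sqr_pair_count;
   rewrite exchange_big /=; under eq_bigr => i _ do rewrite exchange_big /=].
rewrite [RHS]exchange_big; apply: eq_bigr => i _ /=.
rewrite [RHS]exchange_big; apply: eq_bigr => k _ /=.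
(* With the runs [i], [k] fixed, the double sum over columns factors as the square of one
   coincidence. *)
rewrite -mulnn /coincidence big_distrl /=; apply: eq_bigr => j _.
by rewrite big_distrr.
Qed.

Hypotheses (q_gt0 : (0 < q)%N) (hX : balanced X).

Let q_neq0 : q%:R != 0 :> R. Proof. by rewrite pnatr_eq0 -lt0n. Qed.

Lemma sum_column_agreement (j : 'I_s) :
  (\sum_(i < n) \sum_(k < n) (X i j == X k j))%N%:R = n%:R ^+ 2 / q%:R :> R.
Proof.
rewrite -(sum_sqr_card_fiber _ _ (fun i => X i j)) natr_sum.
rewrite (eq_bigr (fun=> (n%:R / q%:R) ^+ 2)) => [|t _].
  by rewrite sumr_const card_ord -mulr_natr; field.
(* Balance enters here: every fiber of a column has exactly n/q runs. *)
by rewrite natrX -[n in n%:R / _](hX j t) natrM mulfK.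
Qed.

Lemma sum_sqr_pair_count_diag (j : 'I_s) :
  (\sum_(t1 < q) \sum_(t2 < q) pair_count X j j t1 t2 ^ 2)%N%:R
    = n%:R ^+ 2 / q%:R :> R.
Proof.
rewrite sum_sqr_pair_count -(sum_column_agreement j); congr _%:R.
by do 2![apply: eq_bigr => ? _]; rewrite mulnb andbb.
Qed.

(** Summed column by column, all ordered pairs of runs give s n^2/q; the diagonal accounts for s n
    of this. *)
Lemma sum_coincidence :
  2 * (\sum_(i < n) \sum_(k < n | (i < k)%N) coincidence X i k)%N%:R
    = s%:R * n%:R * (n%:R - q%:R) / q%:R :> R.
Proof.
have total : (\sum_i \sum_k coincidence X i k)%N%:R
    = s%:R * (n%:R ^+ 2 / q%:R) :> R.
  rewrite /coincidence; under eq_bigr => i _ do rewrite exchange_big /=.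
  rewrite exchange_big natr_sum /=.
  under eq_bigr => j _ do rewrite sum_column_agreement.
  by rewrite sumr_const card_ord mulr_natl.
have := sum_symmetric R n _ coincidence_sym; rewrite total.
under [X in _ = _ + X -> _]eq_bigr => i _ do rewrite coincidence_diag.
rewrite sumr_const card_ord -(mulr_natr s%:R) => E.
have -> : s%:R * n%:R * (n%:R - q%:R) / q%:R
    = s%:R * (n%:R ^+ 2 / q%:R) - s%:R * n%:R :> R by field.
by rewrite E; ring.
Qed.

(** The quadruple count is split along i = k on one side, with diagonal n s^2, and along j = l on
    the other, with diagonal s n^2/q. *)
Lemma sum_sqr_pair_count_Psi :
  2 * (\sum_(j < s) \sum_(l < s | (j < l)%N) \sum_(t1 < q) \sum_(t2 < q)
         pair_count X j l t1 t2 ^ 2)%N%:R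
    = 2 * (Psi_sqr X)%:R + n%:R * s%:R ^+ 2 - s%:R * (n%:R ^+ 2 / q%:R) :> R.
Proof.
have := congr1 (fun m : nat => m%:R : R) sum_sqr_coincidence.
rewrite /= sum_symmetric => [|i k]; last by rewrite coincidence_sym.
under [X in _ + X = _ -> _]eq_bigr => i _ do rewrite coincidence_diag.
rewrite sum_symmetric => [|j l]; last first.
  by rewrite !sum_sqr_pair_count; do 2![apply: eq_bigr => ? _]; rewrite mulnC.
under [X in _ = _ + X -> _]eq_bigr => j _ do rewrite sum_sqr_pair_count_diag.
rewrite !sumr_const !card_ord natrX -(mulr_natl (s%:R ^+ 2)) -(mulr_natl (_ / _)) => E.
by rewrite E addrK.
Qed.

(** With c = n/q^2, the pair counts sum to n over q^2 cells, so the lower terms of the expanded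
    square give -2nc + q^2 c^2 = -n^2/q^2. *)
Lemma sum_chi2 (j l : 'I_s) :
  \sum_(t1 < q) \sum_(t2 < q)
    ((pair_count X j l t1 t2)%:R - n%:R / q%:R ^+ 2) ^+ 2
  = (\sum_(t1 < q) \sum_(t2 < q) pair_count X j l t1 t2 ^ 2)%N%:R
    - n%:R ^+ 2 / q%:R ^+ 2 :> R.
Proof.
pose c : R := n%:R / q%:R ^+ 2.
under eq_bigr => t1 _.
  under eq_bigr => t2 _.
    rewrite (_ : _ ^+ 2 = (pair_count X j l t1 t2 ^ 2)%N%:R
       + ((pair_count X j l t1 t2)%:R * (- 2 * c) + c ^+ 2)); last first.
      by rewrite natrX /c; ring.
    over.
  rewrite 2!big_split /= -mulr_suml -!natr_sum sumr_const card_ord; over.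
rewrite 2!big_split /= -mulr_suml -!natr_sum sumr_const card_ord sum_pair_count.
by rewrite -(mulr_natr (_ *+ _)) -(mulr_natr (_ ^+ _)) /c; field.
Qed.

End Designs.

(** No integer lies strictly between t and t + 1, so the two factors never have opposite signs. *)
Lemma int_between_ge0 (R : realDomainType) (b t : int) :
  0 <= (b%:~R - t%:~R) * (b%:~R - t%:~R - 1) :> R.
Proof.
rewrite -intrB -[1]/(1%:~R) -intrB -intrM ler0z.
by have [le_bt|lt_tb] := lerP b t; [apply: mulr_le0|apply: mulr_ge0]; lia.
Qed.

Theorem theorem4 (R : archiRealFieldType) (n q s : nat)
    (hn : (2 <= n)%N) (hq : (2 <= q)%N) (hs : (2 <= s)%N)
    (X : design n q s) (hX : balanced X) :
  ave_chi2 R X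
    = 2 / (s%:R * (s%:R - 1)) * (Psi_sqr X)%:R + chi2_const R n q s
  /\
  2 / (s%:R * (s%:R - 1)) * (Psi_sqr X)%:R + chi2_const R n q s
    >= n%:R * (n%:R - 1) / (s%:R * (s%:R - 1))
         * (theta R n q s ^+ 2 + 2 * theta R n q s * fpart R n q s
            + fpart R n q s)
       + chi2_const R n q s.
Proof.
have q_gt0 : (0 < q)%N by apply: ltn_trans hq.
have q_neq0 : q%:R != 0 :> R by rewrite pnatr_eq0 -lt0n.
have s_gt0 : 0 < s%:R :> R by rewrite ltr0n (ltn_trans _ hs).
have s1_gt0 : 0 < s%:R - 1 :> R by rewrite subr_gt0 ltr1n.
have n1_gt0 : 0 < n%:R - 1 :> R by rewrite subr_gt0 ltr1n.
have s_neq0 := lt0r_neq0 s_gt0.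
have s1_neq0 := lt0r_neq0 s1_gt0.
have n1_neq0 := lt0r_neq0 n1_gt0.
split.
  set S := (\sum_(j < s) \sum_(l < s | (j < l)%N) \sum_(t1 < q) \sum_(t2 < q)
         pair_count X j l t1 t2 ^ 2)%N.
  set P := (\sum_(j < s) \sum_(l < s | (j < l)%N) 1)%N.
  have -> : ave_chi2 R X
      = 2 / (s%:R * (s%:R - 1)) * (S%:R - P%:R * (n%:R ^+ 2 / q%:R ^+ 2)).
    rewrite /ave_chi2 /S /P !natr_sum mulr_suml -sumrB; congr (_ * _).
    apply: eq_bigr => j _; rewrite !natr_sum mulr_suml -sumrB.
    by apply: eq_bigr => l _; rewrite sum_chi2 // mul1r.
  have ES := sum_sqr_pair_count_Psi R n q s X q_gt0 hX.
  have EP := card_pairs_lt R s.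
  rewrite -/S in ES; rewrite -/P in EP.
  (* The available identities concern doubled sums, so [S] and [P] are put in that form. *)
  have -> : S%:R = (2 * S%:R) / 2 :> R by field.
  have -> : P%:R = (2 * P%:R) / 2 :> R by field.
  rewrite ES EP /chi2_const; field.
  by rewrite s_neq0 s1_neq0 q_neq0.
rewrite lerD2r.
set t := Num.floor (beta_bar R n q s).
set B := (\sum_(i < n) \sum_(k < n | i < k) coincidence X i k)%N.
set P := (\sum_(i < n) \sum_(k < n | (i < k)%N) 1)%N.
(* Since 2P = n(n-1), this says that [beta_bar] is the mean coincidence over the pairs i < k. *)
have EB : 2 * B%:R = n%:R * (n%:R - 1) * beta_bar R n q s.
  by rewrite /B sum_coincidence // /beta_bar; field; rewrite n1_neq0.
have EP : 2 * P%:R = n%:R * (n%:R - 1) :> R := card_pairs_lt R n.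
have : 0 <= \sum_(i < n) \sum_(k < n | (i < k)%N)
    (((coincidence X i k)%:Z%:~R - t%:~R) * ((coincidence X i k)%:Z%:~R - t%:~R - 1)) :> R.
  by do 2![apply: sumr_ge0 => ? _]; apply: int_between_ge0.
have -> : \sum_(i < n) \sum_(k < n | (i < k)%N)
    (((coincidence X i k)%:Z%:~R - t%:~R) * ((coincidence X i k)%:Z%:~R - t%:~R - 1))
    = (Psi_sqr X)%:R - B%:R * (2 * t%:~R + 1) + P%:R * (t%:~R ^+ 2 + t%:~R) :> R.
  rewrite /Psi_sqr /B /P !natr_sum !mulr_suml -sumrB -big_split /=.
  apply: eq_bigr => i _; rewrite !natr_sum !mulr_suml -sumrB -big_split /=.
  by apply: eq_bigr => k _; rewrite natrX -pmulrn; ring.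
move=> ge0.
have c_ge0 : 0 <= (s%:R * (s%:R - 1))^-1 :> R by rewrite invr_ge0 ltW // mulr_gt0.
rewrite -EP mulrAC [leRHS]mulrAC; apply: ler_wpM2r => //.
rewrite -subr_ge0 /fpart /theta -/t.
(* Substituting B = P(t + f) gives B(2t + 1) - P(t^2 + t) = P(t^2 + 2tf + f), so the gap in the
   bound is twice the nonnegative sum above. *)
rewrite (_ : _ - _ = 2 * ((Psi_sqr X)%:R - B%:R * (2 * t%:~R + 1)
    + P%:R * (t%:~R ^+ 2 + t%:~R))) ?mulr_ge0 //.
rewrite [RHS](_ : _ = 2 * (Psi_sqr X)%:R - 2 * B%:R * (2 * t%:~R + 1)
    + 2 * P%:R * (t%:~R ^+ 2 + t%:~R)); last by ring.
by rewrite EB -EP; ring.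
Qed.
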